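(* A linear map $\phi:L_1\to L_1$ is commuting if and only if it is a scalar multiplication map of $L_1$, i.e. if and only if there is $\lambda\in\mathbb{F}$ with $\phi(x)=\lambda x$ for all $x\in L_1$.
   Context: The ground field $\mathbb{F}$ is algebraically closed of characteristic zero. $L_1$ is the $\mathbb{N}$-graded Lie algebra over $\mathbb{F}$ with basis $\{e_i\mid i\geq 1\}$, $e_i$ homogeneous of degree $i$, and brackets $[e_i,e_j]=(j-i)e_{i+j}$ for all $i,j\geq 1$. A linear map $\phi$ of a Lie algebra $\mathfrak{g}$ to itself is called commuting if $[\phi(x),x]=0$ for every $x\in\mathfrak{g}$. *)

(* Defs.v *)
From HB Require Import structures.
From mathcomp Require Import all_boot all_order all_algebra finmap ring zify.
From mathcomp.multinomials Require Import monalg.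

Set Implicit Arguments.
Unset Strict Implicit.
Unset Printing Implicit Defensive.

Import GRing.Theory.
Local Open Scope ring_scope.

HB.mixin Record Lmodule_isLieAlgebra (R : comNzRingType) V
    of GRing.Lmodule R V := {
  lie : V -> V -> V;
  lie_linearl : forall z a x y, lie (a *: x + y) z = a *: lie x z + lie y z;
  lie_linearr : forall z a x y, lie z (a *: x + y) = a *: lie z x + lie z y;
  liexx : forall x, lie x x = 0;
  lie_jacobi : forall x y z,
    lie x (lie y z) + lie y (lie z x) + lie z (lie x y) = 0
}.

#[short(type="lieAlgType")]
HB.structure Definition LieAlgebra (R : comNzRingType) :=
  { V of GRing.Lmodule R V & Lmodule_isLieAlgebra R V }.

Notation "[[ x , y ]]" := (lie x y) (at level 0, format "[[ x ,  y ]]").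

Definition commuting (R : comNzRingType) (g : lieAlgType R) (phi : g -> g) :=
  forall x, [[phi x, x]] = 0.

Definition posnat : Type := {i : nat | (0 < i)%N}.
HB.instance Definition _ := SubType.on posnat.
HB.instance Definition _ := Choice.on posnat.

Lemma posnat_add_subproof (i j : posnat) : (0 < val i + val j)%N.
Proof. by rewrite addn_gt0 (valP i). Qed.

Definition posnat_add (i j : posnat) : posnat := Sub _ (posnat_add_subproof i j).

(* The free F-module on the positive integers: x@_i is the coefficient of x
   on the basis vector indexed by i. *)
Definition L1 (F : fieldType) : Type := {malg F[posnat]}.
HB.instance Definition _ (F : fieldType) := GRing.Lmodule.on (L1 F).

Section L1.
Variable F : fieldType.
Implicit Types (x y z : L1 F) (i j k : posnat).

Definition L1e (i : posnat) : L1 F := << i >>.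

Definition L1_lie x y : L1 F :=
  \sum_(i <- msupp x) \sum_(j <- msupp y)
    (x@_i * y@_j * ((val j)%:R - (val i)%:R)) *: L1e (posnat_add i j).

Lemma L1eE i k : (L1e i)@_k = (i == k)%:R.
Proof. by rewrite /L1e mcoeffU. Qed.

Lemma L1_expand x : x = \sum_(i <- msupp x) x@_i *: L1e i.
Proof.
rewrite {1}[x]monalgE; apply: eq_bigr => i _; apply/malgP => k.
by rewrite mcoeffU mcoeffZ L1eE mulr_natr.
Qed.

Lemma L1e_free (s : seq posnat) (c : posnat -> F) : uniq s ->
  \sum_(i <- s) c i *: L1e i = 0 -> {in s, forall i, c i = 0}.
Proof.
move=> us s0 i si; have: (\sum_(i <- s) c i *: L1e i)@_i = 0 by rewrite s0 mcoeff0.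
rewrite raddf_sum (bigD1_seq i) //= mcoeffZ L1eE eqxx mulr1 big1 ?addr0 // => j ji.
by rewrite mcoeffZ L1eE (negPf ji) mulr0.
Qed.

Lemma L1_lieEw (A B : {fset posnat}) x y :
  (msupp x `<=` A)%fset -> (msupp y `<=` B)%fset ->
  L1_lie x y = \sum_(i <- A) \sum_(j <- B)
    (x@_i * y@_j * ((val j)%:R - (val i)%:R)) *: L1e (posnat_add i j).
Proof.
move=> sA sB; rewrite /L1_lie (big_fset_incl _ sA) => [|i _ iN]; last first.
  by rewrite big1 // => j _; rewrite mcoeff_outdom // !mul0r scale0r.
apply: eq_bigr => i _; apply: (big_fset_incl _ sB) => j _ jN.
by rewrite [y@_j]mcoeff_outdom // mulr0 mul0r scale0r.
Qed.

Lemma L1_lieN x y : L1_lie x y = - L1_lie y x.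
Proof.
rewrite /L1_lie exchange_big -sumrN; apply: eq_bigr => j _.
rewrite -sumrN; apply: eq_bigr => i _; rewrite -scaleNr.
by congr (_ *: L1e _); [ring | apply: val_inj; rewrite /= addnC].
Qed.

Lemma L1_liexx x : L1_lie x x = 0.
Proof.
pose T (P : rel posnat) := \sum_(i <- msupp x) \sum_(j <- msupp x | P i j)
  (x@_i * x@_j * ((val j)%:R - (val i)%:R)) *: L1e (posnat_add i j).
have -> : L1_lie x x = T (fun i j => (val i < val j)%N)
                     + T (fun i j => ~~ (val i < val j)%N).
  by rewrite -big_split; apply: eq_bigr => i _; rewrite [LHS](bigID (fun j => (val i < val j)%N)).
have -> : T (fun i j => ~~ (val i < val j)%N) = - T (fun i j => (val i < val j)%N).
  rewrite /T (exchange_big_dep xpredT) //= -sumrN; apply: eq_bigr => j _.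
  rewrite -sumrN [LHS]big_mkcond [RHS]big_mkcond; apply: eq_bigr => i _.
  have -> : posnat_add i j = posnat_add j i by apply: val_inj; rewrite /= addnC.
  case: (ltngtP (val i) (val j)) => //= [_|->]; last by rewrite subrr mulr0 scale0r.
  by rewrite -scaleNr; congr (_ *: _); ring.
by rewrite subrr.
Qed.

Lemma L1_lie_linearl z a x y :
  L1_lie (a *: x + y) z = a *: L1_lie x z + L1_lie y z.
Proof.
pose A := (msupp x `|` msupp y)%fset.
have sA : (msupp ((a *: x : L1 F) + y) `<=` A)%fset.
  apply: (fsubset_trans (msuppD_le _ _)); apply: fsetSU; exact: msuppZ_le.
have sz := fsubset_refl (msupp z).
have sx : (msupp x `<=` A)%fset by exact: fsubsetUl.
have sy : (msupp y `<=` A)%fset by exact: fsubsetUr.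
rewrite (L1_lieEw sA sz) (L1_lieEw sx sz) (L1_lieEw sy sz).
rewrite scaler_sumr -big_split.
apply: eq_bigr => i _; rewrite scaler_sumr -big_split; apply: eq_bigr => j _ /=.
by rewrite scalerA -scalerDl mcoeffD mcoeffZ; congr (_ *: _); ring.
Qed.

Lemma L1_lie_linearr z a x y :
  L1_lie z (a *: x + y) = a *: L1_lie z x + L1_lie z y.
Proof. by rewrite ![L1_lie z _]L1_lieN L1_lie_linearl opprD scalerN. Qed.

Lemma L1_lie_basis i j :
  L1_lie (L1e i) (L1e j) = ((val j)%:R - (val i)%:R) *: L1e (posnat_add i j).
Proof.
by rewrite /L1_lie /L1e !msuppU oner_eq0 !big_seq_fset1 !mcoeffUU !mul1r.
Qed.

Lemma L1_ind (P : L1 F -> Prop) :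
  (forall i, P (L1e i)) -> P 0 -> (forall a x y, P x -> P y -> P (a *: x + y)) ->
  forall x, P x.
Proof.
move=> Pe P0 PD x; rewrite [x]L1_expand.
by elim: (enum_fset _) => [|i s IH]; rewrite ?big_nil // big_cons; apply: PD.
Qed.

Lemma L1_lie0 x : L1_lie 0 x = 0.
Proof. by rewrite /L1_lie msupp0 big_seq_fset0. Qed.

Local Opaque L1_lie.

Lemma L1_lie_jacobi x y z :
  L1_lie x (L1_lie y z) + L1_lie y (L1_lie z x) + L1_lie z (L1_lie x y) = 0.
Proof.
pose J x y z :=
  L1_lie x (L1_lie y z) + L1_lie y (L1_lie z x) + L1_lie z (L1_lie x y).
have JC u v w : J u v w = J v w u by rewrite /J -[LHS]addrA [LHS]addrC.
have J0 v w : J 0 v w = 0.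
  have L0 u : L1_lie u 0 = 0 by rewrite L1_lieN L1_lie0 oppr0.
  by rewrite /J !(L1_lie0, L0) !addr0.
have JD v w a t u : J t v w = 0 -> J u v w = 0 -> J (a *: t + u) v w = 0.
  move=> Jt Ju; suff -> : J (a *: t + u) v w = a *: J t v w + J u v w.
    by rewrite Jt Ju scaler0 addr0.
  rewrite /J !(L1_lie_linearl, L1_lie_linearr) !scalerDr.
  by rewrite [X in X + _ = _]addrACA [LHS]addrACA.
have ext v w (Je : forall i, J (L1e i) v w = 0) u : J u v w = 0.
  exact: (L1_ind (P := fun u => J u v w = 0) Je (J0 v w) (JD v w)).
change (J x y z = 0).
apply: (ext) => i; rewrite JC; apply: (ext) => j; rewrite JC; apply: (ext) => k.
rewrite /J !L1_lie_basis.
have ZR a u v : L1_lie u (a *: v) = a *: L1_lie u v.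
  by rewrite -[a *: v]addr0 L1_lie_linearr [L1_lie u 0]L1_lieN L1_lie0 oppr0 addr0.
rewrite !ZR !L1_lie_basis !scalerA.
have -> : posnat_add i (posnat_add j k) = posnat_add k (posnat_add i j).
  by apply: val_inj => /=; lia.
have -> : posnat_add j (posnat_add k i) = posnat_add k (posnat_add i j).
  by apply: val_inj => /=; lia.
rewrite -!scalerDl /= !natrD; set c := (X in X *: _).
have -> : c = 0 by rewrite /c; ring.
exact: scale0r.
Qed.

HB.instance Definition _ := Lmodule_isLieAlgebra.Build F (L1 F)
  L1_lie_linearl L1_lie_linearr L1_liexx L1_lie_jacobi.

Lemma L1e_lie i j :
  [[L1e i, L1e j]] = ((val j)%:R - (val i)%:R) *: L1e (posnat_add i j).
Proof. exact: L1_lie_basis. Qed.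

End L1.

(* Main.v *)
Require Import Defs.
From mathcomp Require Import all_boot all_order all_algebra.
From mathcomp.multinomials Require Import monalg.
Import GRing.Theory.
Local Open Scope ring_scope.

(** A commuting map is diagonal in the basis [e_i]: the coefficient of
    [[phi e_i, e_i]] on [e_(k+i)] is [i - k] times that of [phi e_i] on [e_k],
    which must therefore vanish for [k <> i]. Polarization at [e_i + e_j] then
    gives [(lambda_i - lambda_j) (j - i) = 0], so all eigenvalues agree. *)

Section LieAlgebraTheory.
Variables (R : comNzRingType) (g : lieAlgType R).
Implicit Types (a : R) (x y z : g).

Lemma lieDl z x y : [[x + y, z]] = [[x, z]] + [[y, z]].
Proof. by rewrite -[x in LHS]scale1r lie_linearl scale1r. Qed.

Lemma lieDr z x y : [[z, x + y]] = [[z, x]] + [[z, y]].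
Proof. by rewrite -[x in LHS]scale1r lie_linearr scale1r. Qed.

Lemma lie0l z : [[0, z]] = 0 :> g.
Proof. by apply: (addrI [[0, z]]); rewrite -lieDl !addr0. Qed.

Lemma lieZl z a x : [[a *: x, z]] = a *: [[x, z]].
Proof. by rewrite -[a *: x]addr0 lie_linearl lie0l addr0. Qed.

(** Alternation at [x + y] leaves only the two mixed brackets. *)
Lemma lieC x y : [[x, y]] = - [[y, x]].
Proof.
apply/eqP; rewrite -addr_eq0; apply/eqP.
by have := liexx (x + y); rewrite lieDl !lieDr !liexx add0r addr0.
Qed.

Lemma commuting_polar (phi : {linear g -> g}) x y :
  commuting phi -> [[phi x, y]] + [[phi y, x]] = 0.
Proof.
move=> phiC; have := phiC (x + y).
by rewrite linearD lieDl !lieDr !phiC add0r addr0.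
Qed.

End LieAlgebraTheory.

Section L1Theory.
Variable F : fieldType.
Implicit Types (x : L1 F) (i j k : posnat).

Lemma posnat_addIr j : injective (posnat_add^~ j).
Proof. by move=> i k /(congr1 val) /= /addIn; apply: val_inj. Qed.

(** Both sides are linear in [x], so basis vectors suffice; since shifting indices by [j] is
    injective, only the component of [x] on [e_k] reaches [e_(k+j)]. *)
Lemma mcoeff_lieL1e x j k :
  [[x, L1e F j]]@_(posnat_add k j) = x@_k * ((val j)%:R - (val k)%:R).
Proof.
elim/L1_ind: x => [i||a x y IHx IHy].
- rewrite L1e_lie mcoeffZ !L1eE (inj_eq (posnat_addIr j)).
  by case: eqVneq => [->|_]; rewrite ?mulr1 ?mul1r // mulr0 mul0r.
- by rewrite lie0l !mcoeff0 mul0r.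
- by rewrite lie_linearl !mcoeffD !mcoeffZ IHx IHy mulrDl mulrA.
Qed.

Lemma linear_L1_ext (f h : {linear L1 F -> L1 F}) :
  (forall i, f (L1e F i) = h (L1e F i)) -> f =1 h.
Proof.
move=> fh; elim/L1_ind => [//||a x y fx fy]; first by rewrite !linear0.
by rewrite !linearP fx fy.
Qed.

Hypothesis charF : [pchar F] =i pred0.

(** Characteristic zero enters here: the structure constants of distinct indices can be cancelled.
    Up to sign, the difference is the image of a positive natural number. *)
Lemma natr_sub_neq0 (m n : nat) : m != n -> m%:R - n%:R != 0 :> F.
Proof.
wlog le_nm : m n / (n <= m)%N => [hw|] mn.
  case/orP: (leq_total n m) => [|le_mn]; first by move/hw; apply.
  by rewrite -opprB oppr_eq0 hw // eq_sym.
by rewrite -natrB // ((pcharf0P F).1 charF) subn_eq0 -ltnNge ltn_neqAle eq_sym mn.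
Qed.

Lemma commuting_L1e (phi : {linear L1 F -> L1 F}) i :
  commuting phi -> phi (L1e F i) = (phi (L1e F i))@_i *: L1e F i.
Proof.
move=> phiC; apply/malgP => k; rewrite mcoeffZ L1eE.
case: eqVneq => [->|ik]; rewrite ?mulr1 // mulr0; apply/eqP.
have := mcoeff_lieL1e (phi (L1e F i)) i k.
rewrite phiC mcoeff0 => /esym/eqP; rewrite mulf_eq0 => /orP[//|].
by rewrite (negPf (natr_sub_neq0 _ _ _)).
Qed.

Lemma commuting_L1_eigenvalue (phi : {linear L1 F -> L1 F}) i j :
  commuting phi -> (phi (L1e F i))@_i = (phi (L1e F j))@_j.
Proof.
move=> phiC; have [->//|ij] := eqVneq i j.
have := commuting_polar F _ phi (L1e F i) (L1e F j) phiC.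
rewrite (commuting_L1e phi i phiC) (commuting_L1e phi j phiC) !lieZl.
(* Both terms are now multiples of [[[e_i, e_j]]], so the single coefficient on [e_(i+j)] carries
   the whole relation. *)
rewrite (lieC _ _ (L1e F j)) scalerN -scalerBl => /(congr1 (mcoeff (posnat_add i j))).
rewrite mcoeffZ mcoeff_lieL1e mcoeff0 L1eE eqxx mul1r => /eqP.
rewrite mulf_eq0 orbC (negPf (natr_sub_neq0 _ _ _)) ?[val j == _]eq_sym // subr_eq0.
(* The diagonal form was substituted into the goal too; evaluating it restores the eigenvalues. *)
by rewrite !mcoeffZ !L1eE !eqxx !mulr1 => /eqP.
Qed.

End L1Theory.

Theorem theorem3p2 (F : closedFieldType) (charF : [pchar F] =i pred0)
    (phi : {linear L1 F -> L1 F}) :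
  commuting phi <-> exists lambda : F, forall x : L1 F, phi x = lambda *: x.
Proof.
split=> [phiC|[lambda phiE] x]; last by rewrite phiE lieZl liexx scaler0.
pose one : posnat := Sub 1%N isT.
(* All eigenvalues agree, so the one on [e_1] serves as the scalar. *)
exists (phi (L1e F one))@_one.
apply: (linear_L1_ext F phi ( *:%R (phi (L1e F one))@_one)) => i.
by rewrite [LHS](commuting_L1e F charF phi i phiC) (commuting_L1_eigenvalue F charF phi i one phiC).
Qed.
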